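(* Let $X$ be a core compact sober space and let $S\subseteq\mathcal{O}(X)$ be a $\cup$-basis of $X$. Consider the spectrum $\widehat{S}$ of $(S,\leq,\prec)=(S,\subseteq,\Subset)$. Then the map \[x\mapsto S_x=\{s\in S:x\in s\}\] is a homeomorphism from $X$ onto $\widehat{S}$.
   Context: $\mathcal{O}(X)$ is the lattice of open subsets of $X$. For $p,q\in\mathcal{O}(X)$, $p\Subset q$ means: for every $\mathcal{C}\subseteq\mathcal{O}(X)$ with $q\subseteq\bigcup\mathcal{C}$ there is a finite $\mathcal{F}\subseteq\mathcal{C}$ with $p\subseteq\bigcup\mathcal{F}$ (on $S$, $\Subset$ is the restriction of this relation). $X$ is core compact if for every $x\in X$ and every open $O\ni x$ there is an open $N\ni x$ with $N\Subset O$. $X$ is sober if every non-empty irreducible closed set is the closure of a unique point. A $\cup$-basis of $X$ is a basis of the topology of $X$ closed under finite unions, including the empty union (so $\emptyset\in S$); it is a $\vee$-semilattice under $\subseteq$ with minimum $\emptyset$. For a $\vee$-semilattice $(S,\leq)$ with minimum $0$ and a binary relation $\prec$ on $S$: a filter is a non-empty $F\subseteq S$ such that for all $p,q\in S$: $p,q\in F$ iff there is $r\in F$ with $r\leq p,q$. An ideal is a non-empty $I\subseteq S$ such that for all $p,q\in S$: $p,q\in I$ iff there is $r\in I$ with $r\geq p,q$. A filter $P$ is prime if $S\setminus P$ is an ideal; proper if $P\neq S$; round if for every $p\in P$ there is $r\in P$ with $r\prec p$. The spectrum of $(S,\leq,\prec)$ is the set $\widehat{S}$ of all proper round prime filters,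 with the topology generated by the sets $\widehat{S}_p=\{P\in\widehat{S}:p\in P\}$, $p\in S$. *)

(* Defs.v *)
From HB Require Import structures.
From mathcomp Require Import all_boot all_order.
From mathcomp Require Import all_classical topology.

Set Implicit Arguments.
Unset Strict Implicit.
Unset Printing Implicit Defensive.

Import Order.TTheory.

Local Open Scope order_scope.
Local Open Scope classical_set_scope.

Section Topology.
Variable X : topologicalType.
Implicit Types (p q O N C A B : set X) (S CC FF : set (set X)).

Definition compactly_below p q : Prop :=
  forall CC, CC `<=` open -> q `<=` \bigcup_(U in CC) U ->
  exists FF, [/\ FF `<=` CC, finite_set FF & p `<=` \bigcup_(U in FF) U].

Definition core_compact : Prop :=
  forall x O, open O -> O x ->
  exists N, [/\ open N, N x & compactly_below N O].

Definition irreducible_closed C : Prop :=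
  closed C /\
  forall A B, closed A -> closed B -> C = A `|` B -> C = A \/ C = B.

Definition sober : Prop :=
  forall C, C !=set0 -> irreducible_closed C ->
  exists! x : X, C = closure [set x].

(* Taking FF empty gives S set0. *)
Definition cup_basis S : Prop :=
  basis S /\
  forall FF, FF `<=` S -> finite_set FF -> S (\bigcup_(U in FF) U).

Lemma cup_basis0 S : cup_basis S -> S set0.
Proof.
by move=> [_ /(_ set0)]; rewrite bigcup_set0; apply => //; exact: sub0set.
Qed.

Lemma cup_basisU S p q : cup_basis S -> S p -> S q -> S (p `|` q).
Proof.
move=> [_ /(_ [set p; q])] + Sp Sq; rewrite bigcup_setU !bigcup_set1; apply.
  by move=> _ [] ->.
exact: finite_set2.
Qed.

End Topology.

Arguments core_compact : clear implicits.
Arguments sober : clear implicits.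

Definition homeomorphism (X Y : topologicalType) (f : X -> Y) : Prop :=
  continuous f /\ exists g : Y -> X, [/\ cancel f g, cancel g f & continuous g].

Section Semilattice.
Context {d : Order.disp_t} {L : bJoinSemilatticeType d}.
Implicit Types (p q r : L) (F I P : set L).

Definition sl_filter F : Prop :=
  F !=set0 /\
  forall p q, (F p /\ F q) <-> exists r, [/\ F r, r <= p & r <= q].

Definition sl_ideal I : Prop :=
  I !=set0 /\
  forall p q, (I p /\ I q) <-> exists r, [/\ I r, p <= r & q <= r].

Definition sl_prime P : Prop := sl_filter P /\ sl_ideal (~` P).

Definition sl_proper P : Prop := P <> setT.

Definition sl_round (prec : L -> L -> Prop) P : Prop :=
  forall p, P p -> exists r, P r /\ prec r p.

End Semilattice.

Record spectrum {d : Order.disp_t} (L : bJoinSemilatticeType d)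
    (prec : L -> L -> Prop) := Spectrum {
  spectrum_set : set L;
  spectrum_prime : sl_prime spectrum_set;
  spectrum_proper : sl_proper spectrum_set;
  spectrum_round : sl_round prec spectrum_set }.

Section SpectrumTopology.
Context {d : Order.disp_t} {L : bJoinSemilatticeType d}.
Variable prec : L -> L -> Prop.

Lemma spectrum_set_inj : injective (@spectrum_set d L prec).
Proof.
move=> [P Pp Pq Pr] [Q Qp Qq Qr] /= PQ; case: _ / PQ Qp Qq Qr => Qp Qq Qr.
by rewrite (Prop_irrelevance Pp Qp) (Prop_irrelevance Pq Qq)
  (Prop_irrelevance Pr Qr).
Qed.

Definition spectrum_open (p : L) : set (spectrum prec) :=
  [set P : spectrum prec | spectrum_set P p].

HB.instance Definition _ := gen_eqMixin (spectrum prec).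
HB.instance Definition _ := gen_choiceMixin (spectrum prec).

(* The subbase is indexed by itself, since the factory wants a pointed index
   type. *)
HB.instance Definition _ :=
  @isSubBaseTopological.Build (spectrum prec)
    (set (spectrum prec)) (range spectrum_open) id.

End SpectrumTopology.

(* The carrier S; the proof argument is needed to attach the join and the
   bottom element. *)
Definition cup_type (X : topologicalType) (S : set (set X))
  (hS : cup_basis S) : Type := set_type S.

Section CupSemilattice.
Context {X : topologicalType} {S : set (set X)}.
Variable hS : cup_basis S.

Local Notation T := (cup_type hS).

HB.instance Definition _ := SubChoice.copy T (set_type S).
HB.instance Definition _ := [SubChoice_isSubPOrder of T by <: with set_display].

Lemma cup_leE (p q : T) : (p <= q) = `[< val p `<=` val q >].
Proof. by [].   Qed.

Definition cup_join (p q : T) : T :=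
  exist _ (val p `|` val q)
    (mem_set (cup_basisU hS (set_mem (valP p)) (set_mem (valP q)))).

Definition cup_bot : T := exist _ set0 (mem_set (cup_basis0 hS)).

Lemma cup_joinP (p q r : T) : (cup_join p q <= r) = (p <= r) && (q <= r).
Proof.
rewrite !cup_leE; apply/asboolP/andP => /=.
  by rewrite subUset => -[? ?]; split; apply/asboolP.
by move=> [/asboolP ? /asboolP ?]; rewrite subUset.
Qed.

Lemma cup_le0 (p : T) : cup_bot <= p.
Proof. by rewrite cup_leE; apply/asboolP => ?. Qed.

HB.instance Definition _ :=
  Order.POrder_isJoinSemilattice.Build set_display T cup_joinP.
HB.instance Definition _ := Order.hasBottom.Build set_display T cup_le0.

Definition cup_prec (p q : T) : Prop := compactly_below (val p) (val q).

Definition cup_at (x : X) : set T := [set s | val s x].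

End CupSemilattice.

Arguments cup_prec {X S} hS p q.
Arguments cup_at {X S} hS x.

(* Main.v *)
Require Import Defs.
From mathcomp Require Import all_boot all_order.
From mathcomp Require Import all_classical topology.

(**
A proper round prime filter P determines the open set U covered by the members
of S outside P, and its closed complement C. Roundness and compactness show that
s in P iff s meets C: if s in P were contained in U, some r in P with r ⋐ s
would lie below a finite union of elements of the ideal S \ P. Since P is a
filter, C is irreducible; sobriety gives C = cl {x}, and so P = S_x.
*)

Set Implicit Arguments.
Unset Strict Implicit.
Unset Printing Implicit Defensive.

Import Order.TTheory.

Local Open Scope order_scope.
Local Open Scope classical_set_scope.

Section Basis.
Context {X : topologicalType} {S : set (set X)}.
Implicit Types (A B C O U : set X) (x y : X).

Lemma basis_open : basis S -> S `<=` open.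
Proof. by case. Qed.

Lemma basis_nbhs O x : basis S -> open O -> O x ->
  exists s, [/\ S s, s x & s `<=` O].
Proof.
move=> [_ /(_ x O)] bS oO Ox.
by have [|s /= [Ss sx] sO] := bS; [exact: open_nbhs_nbhs|exists s].
Qed.

(** The neighbourhood given by core compactness need not lie in [S]. Shrinking it to a basic one
    keeps it compactly below [O]: the same finite subcovers serve. *)
Lemma core_compact_basis O x : core_compact X -> basis S -> open O -> O x ->
  exists s, [/\ S s, s x & compactly_below s O].
Proof.
move=> hcore bS oO Ox; have [N [oN Nx NO]] := hcore x O oO Ox.
have [s [Ss sx sN]] := basis_nbhs bS oN Nx.
exists s; split => // CC /NO/[apply] -[FF [FC fF NF]].
by exists FF; split => //; exact: subset_trans NF.
Qed.

Lemma open_meets_closure1 U x : open U -> (U `&` closure [set x] !=set0) <-> U x.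
Proof.
move=> oU; split=> [[y [Uy /(_ U)]]|Ux].
  by case=> [|_ [-> //]]; exact: open_nbhs_nbhs.
by exists x; split => //; exact: subset_closure.
Qed.

(** Whichever of [A], [B] contains [x], being closed, contains all of [closure [set x]]. *)
Lemma irreducible_closure1 x : irreducible_closed (closure [set x]).
Proof.
split=> [|A B cA cB clE]; first exact: closed_closure.
have [] : (A `|` B) x by rewrite -clE; exact: subset_closure.
- move=> Ax; left; apply/seteqP; split; last by rewrite clE; exact: subsetUl.
  by move/closure_id: cA => ->; apply: closureS => _ ->.
- move=> Bx; right; apply/seteqP; split; last by rewrite clE; exact: subsetUr.
  by move/closure_id: cB => ->; apply: closureS => _ ->.
Qed.

Lemma sober_closure1_inj : sober X -> injective (fun x => closure [set x]).
Proof.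
move=> hsober x y xy.
have [|z [_ zu]] := hsober _ _ (irreducible_closure1 x).
  by exists x; exact: subset_closure.
by rewrite -(zu x)// (zu y).
Qed.

(** If [C] lay in neither [A] nor [B], basic sets [s] off [A] and [t] off [B] would meet [C]; then
    [r] would contain a point of [C] outside both. *)
Lemma basis_irreducible C : basis S -> closed C ->
  (forall s t, S s -> S t -> s `&` C !=set0 -> t `&` C !=set0 ->
    exists r, [/\ r `<=` s, r `<=` t & r `&` C !=set0]) ->
  irreducible_closed C.
Proof.
move=> bS cC meetC; split => // A B cA cB CE.
have meet_setC D : closed D -> ~ (C `<=` D) ->
    exists s, [/\ S s, s `<=` ~` D & s `&` C !=set0].
  move=> cD /existsNP[x /not_implyP[Cx nDx]].
  have [||s [Ss sx sD]] := @basis_nbhs (~` D) x bS => //; first exact: closed_openC.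
  by exists s; split => //; exists x.
have [CA|/(meet_setC _ cA)[s [Ss sA sC]]] := pselect (C `<=` A).
  by left; apply/seteqP; split => //; rewrite CE; exact: subsetUl.
have [CB|/(meet_setC _ cB)[t [St tB tC]]] := pselect (C `<=` B).
  by right; apply/seteqP; split => //; rewrite CE; exact: subsetUr.
have [r [rs rt [x [rx]]]] := meetC s t Ss St sC tC.
by rewrite {1}CE => -[/(sA _ (rs _ rx))|/(tB _ (rt _ rx))].
Qed.

End Basis.

Section Spectrum.
Context {X : topologicalType} {S : set (set X)}.
Variable hS : cup_basis S.

Local Notation T := (cup_type hS).
Implicit Types (p q r s : T) (P I : set T) (x y : X).

Lemma cup_leP p q : reflect (val p `<=` val q) (p <= q).
Proof. by rewrite cup_leE; exact: asboolP. Qed.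

Lemma cup_mem p : S (val p).
Proof. exact: set_mem (valP p). Qed.

Lemma cup_lift (s : set X) : S s -> exists p, val p = s.
Proof. by move=> Ss; exists (exist _ s (mem_set Ss)). Qed.

Lemma cup_open p : open (val p).
Proof. by apply: (basis_open hS.1); exact: cup_mem. Qed.

Lemma cup_nbhs (O : set X) x : open O -> O x ->
  exists p, val p x /\ val p `<=` O.
Proof.
move=> oO Ox; have [s [/cup_lift[p <-] ? ?]] := basis_nbhs hS.1 oO Ox.
by exists p.
Qed.

Lemma cup_at_filter x : sl_filter (cup_at hS x).
Proof.
split=> [|p q].
  by have [p []] := cup_nbhs openT (I : setT x); exists p.
split=> [[px qx]|[r [rx /cup_leP rp /cup_leP rq]]]; last first.
  by split; [exact: rp|exact: rq].
(* [S] need not be closed under intersections, so the lower bound is a basic neighbourhood of [x]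
   inside the intersection. *)
have [r [rx]] := cup_nbhs (openI (cup_open p) (cup_open q)) (conj px qx).
by rewrite subsetI => -[rp rq]; exists r; split => //; exact/cup_leP.
Qed.

Lemma cup_at_prime x : sl_prime (cup_at hS x).
Proof.
split; first exact: cup_at_filter.
split=> [|p q]; first by exists (cup_bot hS).
split=> [[px qx]|[r [rx /cup_leP pr /cup_leP qr]]]; last first.
  by split=> [/pr|/qr].
exists (cup_join p q); split; first by case.
  by apply/cup_leP; exact: subsetUl.
by apply/cup_leP; exact: subsetUr.
Qed.

Lemma cup_at_proper x : sl_proper (cup_at hS x).
Proof. by move/seteqP => -[_ /(_ (cup_bot hS) I)]. Qed.

Lemma cup_at_round x : core_compact X -> sl_round (cup_prec hS) (cup_at hS x).
Proof.
move=> hcore p px.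
have [s [/cup_lift[r <-] rx rp]] := core_compact_basis hcore hS.1 (cup_open p) px.
by exists r.
Qed.

Definition cup_point (hcore : core_compact X) x : spectrum (cup_prec hS) :=
  Spectrum (cup_at_prime x) (@cup_at_proper x) (cup_at_round hcore).

(** Ideals are non-empty and upward directed. This collapses a finite subcover by elements outside a
    prime filter to a single such element. *)
Lemma sl_ideal_finite_bound I (FF : set (set X)) : sl_ideal I -> finite_set FF ->
  FF `<=` val @` I -> exists2 r, I r & \bigcup_(U in FF) U `<=` val r.
Proof.
move=> [[i Ii] dirI] /finite_seqP[s ->].
elim: s => [_|U s IHs sI]; first by exists i => // x [].
have [|r Ir sr] := IHs.
  by move=> V Vs; apply: sI; rewrite /= inE; apply/orP; right.
have [|p Ip pU] := sI U; first by rewrite /= mem_head.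
have [q [Iq /cup_leP pq /cup_leP rq]] := (dirI p r).1 (conj Ip Ir).
exists q => // x [V /=]; rewrite inE => /orP[/eqP-> Ux|Vs Vx].
  by apply: pq; rewrite pU.
by apply: rq; apply: sr; exists V.
Qed.

Section RoundPrimeFilter.
Variable P : set T.
Hypotheses (Pprime : sl_prime P) (Pproper : sl_proper P)
  (Pround : sl_round (cup_prec hS) P).

Let C : set X := ~` \bigcup_(U in val @` ~` P) U.

Let closedC : closed C.
Proof.
by apply: open_closedC; apply: bigcup_open => _ [p _ <-]; exact: cup_open.
Qed.

Lemma mem_round_prime p : P p <-> val p `&` C !=set0.
Proof.
have [_ [_ idP]] := Pprime; have [[_ filP] ideP] := Pprime.
split=> [Pp|[x [px Cx]]]; last first.
  by apply: contrapT => nPp; apply: Cx; exists (val p) => //; exists p.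
apply: contrapT => pC0.
have pU : val p `<=` \bigcup_(U in val @` ~` P) U.
  by move=> x px; apply: contrapT => Cx; apply: pC0; exists x.
have [r [Pr rp]] := Pround Pp.
have [|FF [FFP finF rF]] := rp _ _ pU; first by move=> _ [q _ <-]; exact: cup_open.
have [q nPq Fq] := sl_ideal_finite_bound ideP finF FFP.
have rq : r <= q by apply/cup_leP; exact: subset_trans Fq.
(* With [q] as upper bound of both [r] and [q], the ideal law gives downward closure: [r] lies
   outside [P], a contradiction. *)
by have [] := (idP r q).2 (ex_intro _ q (And3 nPq rq (lexx q))).
Qed.

Lemma round_prime_point : sober X -> exists x, P = cup_at hS x.
Proof.
move=> hsober; have [[[p0 Pp0] filP] _] := Pprime.
have [||x [CE _]] := hsober C.
- by have [x [_ Cx]] := (mem_round_prime p0).1 Pp0; exists x.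
- apply: (basis_irreducible hS.1 closedC) => _ _ /cup_lift[p <-] /cup_lift[q <-].
  move=> /mem_round_prime Pp /mem_round_prime Pq.
  have [r [/mem_round_prime rC /cup_leP ? /cup_leP ?]] := (filP p q).1 (conj Pp Pq).
  by exists (val r).
- exists x; apply/seteqP; split=> p.
  + by move/mem_round_prime; rewrite CE => /(open_meets_closure1 _ (cup_open p)).
  + by move=> px; apply/mem_round_prime; rewrite CE;
      apply/(open_meets_closure1 _ (cup_open p)).
Qed.

End RoundPrimeFilter.

(** Sobriety separates points by their closures, and [cup_at] determines the closure: a basic
    neighbourhood of [z] missing [closure [set v]] contains [u] but not [v]. *)
Lemma cup_at_inj : sober X -> injective (cup_at hS).
Proof.
move=> hsober x y xy; apply: (sober_closure1_inj hsober).
have cl_sub u v : cup_at hS u `<=` cup_at hS v -> closure [set u] `<=` closure [set v].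
  move=> uv z zu; apply: contrapT => nzv.
  have [p [pz pv]] := cup_nbhs (closed_openC (@closed_closure _ [set v])) nzv.
  have : cup_at hS u p.
    by apply/(open_meets_closure1 u (cup_open p)); exists z.
  by move=> /uv /pv; apply; exact: subset_closure.
by apply/seteqP; split; apply: cl_sub; rewrite xy.
Qed.

Lemma open_spectrum_open p : open (spectrum_open p : set (spectrum (cup_prec hS))).
Proof.
exists [set spectrum_open p]; last by rewrite bigcup_set1.
by move=> _ ->; apply: (@finI_from1 _ _ (range _) id); exists p.
Qed.

Lemma continuous_spectrum (Y : topologicalType) (f : Y -> spectrum (cup_prec hS)) :
  (forall p, open (f @^-1` spectrum_open p)) -> continuous f.
Proof.
move=> fo; apply/continuousP => _ [D' D'b <-].
rewrite preimage_bigcup; apply: bigcup_open => A /D'b[E Eb <-].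
(* Finite intersections are handled pointwise: the neighbourhoods of [y] form a filter. *)
rewrite openE => y fy; rewrite /interior preimage_bigcap.
apply: filter_bigI => B BE; have /set_mem[p _ pB] := Eb B BE.
by apply: open_nbhs_nbhs; split; [rewrite -pB; exact: fo|exact: fy].
Qed.

End Spectrum.

Theorem theorem1p6 (X : topologicalType) (S : set (set X))
    (hcore : core_compact X) (hsober : sober X) (hS : cup_basis S) :
  exists h : X -> spectrum (cup_prec hS),
    (forall x, spectrum_set (h x) = cup_at hS x) /\ homeomorphism h.
Proof.
exists (cup_point hS hcore); split => //; split.
  (* The preimage of [spectrum_open p] is [val p] by conversion. *)
  by apply: continuous_spectrum => p; exact: cup_open.
have surj (P : spectrum (cup_prec hS)) : exists x, spectrum_set P = cup_at hS x.
  by case: P => P Pprime Pproper Pround; exact: round_prime_point hsober.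
have [g gE] := choice surj.
exists g; split=> [x|P|].
- by apply: (@cup_at_inj _ _ hS hsober); rewrite -gE.
- by apply: (@spectrum_set_inj _ _ (cup_prec hS)); exact: esym (gE P).
(* For basic [p] around [g P] inside [O], [g] maps [spectrum_open p] into [val p], since each [Q] is
   [cup_at hS (g Q)]. *)
- move=> P A; rewrite nbhsE => -[O [oO OgP] OA].
  have [p [pgP pO]] := cup_nbhs hS oO OgP.
  apply: (@filterS _ _ _ (spectrum_open p)) => [Q Qp|].
    by apply/OA/pO; have : spectrum_set Q p := Qp; rewrite gE.
  apply: open_nbhs_nbhs; split; first exact: open_spectrum_open.
  by rewrite /spectrum_open /= gE.
Qed.
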